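(* Let $\mathcal C$ be a small category. If $\mathcal O\subseteq\mathcal O'$ are orbit families for $\mathcal C$, then $\mathrm{cat}_{\mathcal C}^{\mathcal O'}(\mathbb X)\leq\mathrm{cat}_{\mathcal C}^{\mathcal O}(\mathbb X)$ for every $\mathcal C$-space $\mathbb X$. In particular, \[ \mathrm{cat}_{\mathcal C}^{\mathrm{top}}(\mathbb X)\leq\mathrm{cat}_{\mathcal C}^{\mathrm{disc}}(\mathbb X)\leq\mathrm{cat}_{\mathcal C}^{\mathrm{rep}}(\mathbb X). \]
   Context: $\mathrm{Top}$ is the category of compactly generated topological spaces; products and subspaces are taken in compactly generated spaces. A $\mathcal C$-space is a functor $\mathbb X\colon\mathcal C\to\mathrm{Top}$; a $\mathcal C$-map is a natural transformation. Products are objectwise; a space $K$ is also regarded as a constant $\mathcal C$-space; $\mathbb I=[0,1]$. A $\mathcal C$-homotopy from $f$ to $g$ (with $f,g\colon\mathbb X\to\mathbb Y$) is a $\mathcal C$-map $H\colon\mathbb X\times\mathbb I\to\mathbb Y$ with $H_0=f$, $H_1=g$; then write $f\simeq_{\mathcal C}g$. A topological $\mathcal C$-orbit is a $\mathcal C$-space $\mathbb T$ with $\varinjlim_{\mathcal C}\mathbb T\cong *$ (colimit in $\mathrm{Top}$). An orbit family for $\mathcal C$ is a class $\mathcal O$ of topological $\mathcal C$-orbits, closed under isomorphism and containing every representable $\mathcal C(c,-)$, regarded as an objectwise discrete $\mathcal C$-space. Canonical families: $\mathcal O_{\mathrm{rep}}(\mathcal C)$ is the class of all $\mathcal C(c,-)$,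 closed under isomorphism; $\mathcal O_{\mathrm{disc}}(\mathcal C)$ is the class of functors $S\colon\mathcal C\to\mathrm{Set}$ with $\varinjlim_{\mathcal C}^{\mathrm{Set}}S\cong *$, regarded as objectwise discrete $\mathcal C$-spaces; $\mathcal O_{\mathrm{top}}(\mathcal C)$ is the class of all topological $\mathcal C$-orbits. An open $\mathcal C$-subspace $\mathbb U\subseteq\mathbb X$ is a family of open subspaces $\mathbb U(c)\subseteq\mathbb X(c)$ stable under the structure maps (with restricted structure maps); $\iota_{\mathbb U}\colon\mathbb U\hookrightarrow\mathbb X$ is the inclusion. An open cover of $\mathbb X$ is a collection $\{\mathbb U_i\}$ of open $\mathcal C$-subspaces with $\mathbb X(c)=\bigcup_i\mathbb U_i(c)$ for every object $c$. $\mathbb U$ is $\mathcal O$-categorical in $\mathbb X$ if there are $\mathbb T\in\mathcal O$ and $\mathcal C$-maps $a\colon\mathbb U\to\mathbb T$, $O\colon\mathbb T\to\mathbb X$ with $\iota_{\mathbb U}\simeq_{\mathcal C}O\circ a$. $\mathrm{cat}_{\mathcal C}^{\mathcal O}(\mathbb X)$ is the least integer $n\ge0$ such that $\mathbb X$ has an open cover $\{\mathbb U_0,\dots,\mathbb U_n\}$ by $\mathcal O$-categorical open $\mathcal C$-subspaces ($\infty$ if none exists). $\mathrm{cat}_{\mathcal C}^{\mathrm{rep}}$, $\mathrm{cat}_{\mathcal C}^{\mathrm{disc}}$, $\mathrm{cat}_{\mathcal C}^{\mathrm{top}}$ denote $\mathrm{cat}_{\mathcal C}^{\mathcal O}$ for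 $\mathcal O=\mathcal O_{\mathrm{rep}}(\mathcal C),\mathcal O_{\mathrm{disc}}(\mathcal C),\mathcal O_{\mathrm{top}}(\mathcal C)$ respectively. *)

(* Defs.v *)
From HB Require Import structures.
From mathcomp Require Import all_boot all_order all_algebra.
From mathcomp Require Import all_classical all_reals all_analysis.

Set Implicit Arguments.
Unset Strict Implicit.
Unset Printing Implicit Defensive.

Import Order.TTheory GRing.Theory Num.Theory.
Import numFieldNormedType.Exports.

Local Open Scope classical_set_scope.

(* Compactly generated in the sense of k-spaces: the topology is determined by
   the continuous maps from compact Hausdorff spaces. No (weak) Hausdorff
   condition is imposed. *)
Definition kopen (X : topologicalType) (A : set X) : Prop :=
  forall (K : topologicalType) (u : K -> X),
    compact [set: K] -> hausdorff_space K -> continuous u -> open (u @^-1` A).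

Definition compactly_generated (X : topologicalType) : Prop :=
  forall A : set X, kopen A -> open A.

(* The k-ification of X: same points, with the k-open sets as open sets. Limits
   of compactly generated spaces are k-ifications of the usual ones. *)
Definition kify (X : Type) : Type := X.

Section Kify.
Variable X : topologicalType.

Let kopenT : kopen [set: X].
Proof. by move=> K u _ _ _; rewrite preimage_setT; exact: openT. Qed.

Let kopenI : setI_closed (@kopen X).
Proof.
move=> A B kA kB K u cK hK cu; rewrite preimage_setI.
by apply: openI; [exact: kA|exact: kB].
Qed.

Let kopen_bigU (I : Type) (f : I -> set X) :
  (forall i, kopen (f i)) -> kopen (\bigcup_i f i).
Proof.
move=> kf K u cK hK cu; rewrite preimage_bigcup.
by apply: bigcup_open => i _; exact: kf.
Qed.

HB.instance Definition _ := Choice.copy (kify X) X.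
HB.instance Definition _ :=
  isOpenTopological.Build (kify X) kopenT kopenI kopen_bigU.

Lemma kify_openE (A : set (kify X)) : open A = @kopen X A.
Proof. by []. Qed.

Lemma continuous_kify (K : topologicalType) (u : K -> X) :
  compact [set: K] -> hausdorff_space K -> continuous u ->
  continuous (u : K -> kify X).
Proof.
by move=> cK hK cu; apply/continuousP => A; rewrite kify_openE; apply.
Qed.

Lemma kify_cg : compactly_generated (kify X).
Proof.
move=> A kA; rewrite kify_openE => K u cK hK cu.
by apply: kA => //; exact: continuous_kify.
Qed.

End Kify.

Lemma kify_continuous (X Y : topologicalType) (f : X -> Y) :
  continuous f -> continuous (f : kify X -> kify Y).
Proof.
move=> cf; apply/continuousP => A; rewrite !kify_openE => kA K u cK hK cu.
rewrite -comp_preimage; apply: kA => // x.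
by apply: continuous_comp; [exact: cu|exact: cf].
Qed.

Lemma of_kify_continuous (X : topologicalType) :
  continuous (id : kify X -> X).
Proof.
apply/continuousP => A oA; rewrite kify_openE => K u _ _ cu.
by move/continuousP: cu; apply.
Qed.

Lemma compact_hausdorff_cg (X : topologicalType) :
  compact [set: X] -> hausdorff_space X -> compactly_generated X.
Proof. by move=> cX hX A /(_ X id cX hX); apply => x. Qed.

Record cgspace := CGSpace {
  cg_top :> topologicalType;
  cg_topP : compactly_generated cg_top
}.

Definition cg_kify (X : topologicalType) : cgspace := CGSpace (@kify_cg X).

Definition cg_prod (X Y : cgspace) : cgspace := cg_kify (X * Y)%type.

Definition cg_sub (X : cgspace) (A : set X) : cgspace := cg_kify (set_type A).

Definition cg_discrete (T : Type) : cgspace :=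
  @CGSpace (discrete_topology {classic T}) (fun A _ => discrete_open A).

Definition homeomorphic (X Y : cgspace) : Prop :=
  exists (f : X -> Y) (g : Y -> X),
    [/\ continuous f, continuous g, cancel f g & cancel g f].

Section UnitInterval.
Variable R : realType.
Local Open Scope ring_scope.

Let I : topologicalType := set_type `[0 : R, 1].

Let I_compact : compact [set: I].
Proof.
move=> F PF _.
have [|r [r01 clr]] := @segment_compact R 0 1 (set_val @ F).
  apply: (@filterS _ F _ setT) => [x _|]; [exact: (@set_valP R _ x)|exact: filterT].
exists (exist _ r (mem_set r01)); split=> // A B FA.
rewrite nbhsE => -[_ [[W oW <-] /= Wr] sWB].
have [_ [[x Ax <-] Wx]] : (set_val @` A) `&` W !=set0.
  apply: clr; last by apply: open_nbhs_nbhs; split.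
  by apply: (@filterS _ F _ A) => [x Ax|]; [exists x|exact: FA].
by exists x; split => //; exact: sWB.
Qed.

Let I_hausdorff : hausdorff_space I.
Proof.
move=> x y clxy; apply: val_inj; apply: (@Rhausdorff R) => A B Ax By.
have nA := @initial_continuous I R set_val x _ Ax.
have nB := @initial_continuous I R set_val y _ By.
have [z [Az Bz]] := clxy _ _ nA nB.
by exists (set_val z).
Qed.

Definition unit_interval : cgspace :=
  CGSpace (compact_hausdorff_cg I_compact I_hausdorff).

Let mem0 : (0 : R) \in `[0 : R, 1]%classic.
Proof. by rewrite inE /= in_itv /= lexx ler01. Qed.

Let mem1 : (1 : R) \in `[0 : R, 1]%classic.
Proof. by rewrite inE /= in_itv /= lexx ler01. Qed.

Definition I0 : unit_interval := exist _ 0 mem0.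
Definition I1 : unit_interval := exist _ 1 mem1.

End UnitInterval.

(* Smallness: the objects form a type, and the hom-types live in the same
   universe as the carriers of topological spaces. *)
Record category := Category {
  obj :> Type;
  hom : obj -> obj -> Type;
  idc : forall c, hom c c;
  compc : forall a b c, hom b c -> hom a b -> hom a c;
  compc1 : forall a b (f : hom a b), compc f (idc a) = f;
  comp1c : forall a b (f : hom a b), compc (idc b) f = f;
  compcA : forall a b c d (f : hom c d) (g : hom b c) (h : hom a b),
    compc f (compc g h) = compc (compc f g) h
}.

Record setfunctor (C : category) := SetFunctor {
  sf_obj :> C -> Type;
  sf_map : forall c d, hom c d -> sf_obj c -> sf_obj d;
  sf_id : forall c x, sf_map (idc c) x = x;
  sf_comp : forall a b c (g : hom b c) (f : hom a b) x,
    sf_map (compc g f) x = sf_map g (sf_map f x)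
}.

Record cspace (C : category) := CSpace {
  cs_obj :> C -> cgspace;
  cs_map : forall c d, hom c d -> cs_obj c -> cs_obj d;
  cs_cts : forall c d (f : hom c d), continuous (cs_map f);
  cs_id : forall c x, cs_map (idc c) x = x;
  cs_comp : forall a b c (g : hom b c) (f : hom a b) x,
    cs_map (compc g f) x = cs_map g (cs_map f x)
}.

Record cmap (C : category) (X Y : cspace C) := CMap {
  cm_fun :> forall c, X c -> Y c;
  cm_cts : forall c, continuous (@cm_fun c);
  cm_nat : forall c d (f : hom c d) x,
    cm_fun (cs_map f x) = cs_map f (cm_fun x)
}.
Arguments cm_fun {C X Y} _ c _.

Definition ciso (C : category) (X Y : cspace C) : Prop :=
  exists (f : cmap X Y) (g : cmap Y X),
    forall c, cancel (f c) (g c) /\ cancel (g c) (f c).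

Section Constructions.
Variable C : category.

Section Comp.
Variables (X Y Z : cspace C) (g : cmap Y Z) (f : cmap X Y).

Let comp_fun c (x : X c) : Z c := g c (f c x).

Let comp_cts c : continuous (@comp_fun c).
Proof.
by move=> x; apply: continuous_comp; [exact: cm_cts|exact: cm_cts].
Qed.

Let comp_nat c d (h : hom c d) x :
  comp_fun (cs_map h x) = cs_map h (comp_fun x).
Proof. by rewrite /comp_fun !cm_nat. Qed.

Definition ccomp : cmap X Z := CMap comp_cts comp_nat.
End Comp.

Section Const.
Variable K : cgspace.

Let const_cts (c d : C) (f : hom c d) : continuous (id : K -> K).
Proof. by move=> x. Qed.

Definition cconst : cspace C :=
  @CSpace C (fun=> K) (fun _ _ _ x => x) const_cts
    (fun _ _ => erefl) (fun _ _ _ _ _ _ => erefl).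
End Const.

Section Prod.
Variables X Y : cspace C.

Let prod_map c d (f : hom c d) (p : cg_prod (X c) (Y c)) :
  cg_prod (X d) (Y d) := (cs_map f p.1, cs_map f p.2).

Let prod_cts c d (f : hom c d) : continuous (prod_map f).
Proof.
apply: (@kify_continuous (X c * Y c)%type (X d * Y d)%type) => -[x y].
apply: cvg_pair => /=.
- by apply: (cvg_comp fst (cs_map f) cvg_fst); exact: cs_cts.
- by apply: (cvg_comp snd (cs_map f) cvg_snd); exact: cs_cts.
Qed.

Let prod_id c p : prod_map (idc c) p = p.
Proof. by case: p => x y; rewrite /prod_map /= !cs_id. Qed.

Let prod_comp a b c (g : hom b c) (f : hom a b) p :
  prod_map (compc g f) p = prod_map g (prod_map f p).
Proof. by rewrite /prod_map !cs_comp. Qed.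

Definition cprod : cspace C :=
  @CSpace C (fun c => cg_prod (X c) (Y c)) prod_map prod_cts prod_id prod_comp.
End Prod.

Section Discrete.
Variable S : setfunctor C.

Let disc_cts c d (f : hom c d) :
  continuous (sf_map f : cg_discrete (S c) -> cg_discrete (S d)).
Proof. by apply/continuousP => A _; exact: discrete_open. Qed.

Definition cdiscrete : cspace C :=
  @CSpace C (fun c => cg_discrete (S c)) _ disc_cts (@sf_id C S) (@sf_comp C S).
End Discrete.

Definition hom_functor (c : C) : setfunctor C :=
  @SetFunctor C (hom c) (fun _ _ f g => compc f g)
    (fun _ g => comp1c g) (fun _ _ _ g f h => esym (compcA g f h)).

End Constructions.

Record cocone (C : category) (T : cspace C) (L : cgspace) := Cocone {
  leg :> forall c, T c -> L;
  leg_cts : forall c, continuous (@leg c);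
  leg_nat : forall c d (f : hom c d) x, leg (cs_map f x) = leg x
}.
Arguments leg {C T L} _ c _.

Definition is_colimit (C : category) (T : cspace C) (L : cgspace)
    (l : cocone T L) : Prop :=
  forall (Y : cgspace) (k : cocone T Y),
    exists! u : L -> Y, continuous u /\ forall c x, u (l c x) = k c x.

Record set_cocone (C : category) (S : setfunctor C) (L : Type) := SetCocone {
  sleg :> forall c, S c -> L;
  sleg_nat : forall c d (f : hom c d) x, sleg (sf_map f x) = sleg x
}.
Arguments sleg {C S L} _ c _.

Definition is_set_colimit (C : category) (S : setfunctor C) (L : Type)
    (l : set_cocone S L) : Prop :=
  forall (Y : Type) (k : set_cocone S Y),
    exists! u : L -> Y, forall c x, u (l c x) = k c x.

Definition topological_orbit (C : category) (T : cspace C) : Prop :=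
  exists (L : cgspace) (l : cocone T L),
    is_colimit l /\ homeomorphic L (cg_discrete unit).

Definition set_orbit (C : category) (S : setfunctor C) : Prop :=
  exists (L : Type) (l : set_cocone S L),
    is_set_colimit l /\ exists f : L -> unit, bijective f.

Record orbit_family (C : category) (O : cspace C -> Prop) : Prop := {
  orbit_family_orbit : forall T, O T -> topological_orbit T;
  orbit_family_iso : forall T T', ciso T T' -> O T -> O T';
  orbit_family_rep : forall c : C, O (cdiscrete (hom_functor c))
}.

(* The canonical families consist of C-spaces, so they are closed under
   isomorphism of C-spaces. *)
Definition Orep (C : category) (T : cspace C) : Prop :=
  exists c : C, ciso (cdiscrete (hom_functor c)) T.

Definition Odisc (C : category) (T : cspace C) : Prop :=
  exists2 S : setfunctor C, set_orbit S & ciso (cdiscrete S) T.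

Definition Otop (C : category) (T : cspace C) : Prop := topological_orbit T.

Record open_csubspace (C : category) (X : cspace C) := OpenCSubspace {
  os_set :> forall c, set (X c);
  os_open : forall c, open (@os_set c);
  os_stable : forall c d (f : hom c d) x, os_set x -> os_set (cs_map f x)
}.
Arguments os_set {C X} _ c _.

Section Subspace.
Variables (C : category) (X : cspace C) (U : open_csubspace X).

Let sub_map c d (f : hom c d) (x : cg_sub (U c)) : cg_sub (U d) :=
  exist _ (cs_map f (set_val x))
    (mem_set (os_stable f (set_mem (svalP x)))).

Let sub_cts c d (f : hom c d) : continuous (sub_map f).
Proof.
apply: (@kify_continuous (set_type (U c)) (set_type (U d))).
apply/continuousP => _ [A oA <-].
exists (cs_map f @^-1` A) => //.
by move/continuousP: (@cs_cts C X c d f); apply.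
Qed.

Let sub_id c x : sub_map (idc c) x = x.
Proof. by apply: val_inj; exact: cs_id. Qed.

Let sub_comp a b c (g : hom b c) (f : hom a b) x :
  sub_map (compc g f) x = sub_map g (sub_map f x).
Proof. by apply: val_inj; exact: cs_comp. Qed.

Definition csub : cspace C :=
  @CSpace C (fun c => cg_sub (U c)) sub_map sub_cts sub_id sub_comp.

Let incl_cts c : continuous (set_val : csub c -> X c).
Proof.
apply/continuousP => A oA.
have oB : open (set_val @^-1` A : set (set_type (U c))) by exists A.
have /continuousP := @of_kify_continuous (set_type (U c)).
by move=> /(_ _ oB).
Qed.

Let incl_nat c d (f : hom c d) (x : csub c) :
  set_val (cs_map f x) = cs_map f (set_val x).
Proof. by []. Qed.

Definition cincl : cmap csub X := CMap incl_cts incl_nat.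
End Subspace.

Definition chomotopic (R : realType) (C : category) (X Y : cspace C)
    (f g : cmap X Y) : Prop :=
  exists H : cmap (cprod X (cconst C (unit_interval R))) Y,
    (forall c x, H c (x, I0 R) = f c x) /\
    (forall c x, H c (x, I1 R) = g c x).

Definition categorical (R : realType) (C : category) (O : cspace C -> Prop)
    (X : cspace C) (U : open_csubspace X) : Prop :=
  exists T : cspace C, O T /\
    exists (a : cmap (csub U) T) (o : cmap T X),
      chomotopic R (cincl U) (ccomp o a).

Definition open_cover (C : category) (X : cspace C) (I : Type)
    (U : I -> open_csubspace X) : Prop :=
  forall c, \bigcup_i U i c = [set: X c].

Definition has_cat_cover (R : realType) (C : category) (O : cspace C -> Prop)
    (X : cspace C) (n : nat) : Prop :=
  exists U : 'I_n.+1 -> open_csubspace X,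
    open_cover U /\ forall i, categorical R O (U i).

(* An extended natural number, seen in \bar int for its order. *)
Definition lscat (R : realType) (C : category) (O : cspace C -> Prop)
    (X : cspace C) : \bar int :=
  if pselect (exists n, `[< has_cat_cover R O X n >]) is left ex
  then (Posz (ex_minn ex))%:E else +oo%E.

(* Main.v *)
Require Import Defs.
From mathcomp Require Import all_boot all_order all_algebra.
From mathcomp Require Import all_classical all_reals all_analysis.

(** A cover by [O]-categorical open subspaces is, for a larger class [O'], a
    cover by [O']-categorical ones: the same orbits and homotopies serve. So
    enlarging the class can only lower the least size of such a cover
    ([lscat_anti]).

    The chain for the canonical families then reduces to two inclusions.
    Representables are set-valued orbits: by the Yoneda argument a cocone on
    [hom c] is constant, with the value it takes at the identity of [c]
    ([set_orbit_hom]). Set-valued orbits are topological orbits: every map out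
    of a discrete space is continuous, so the universal property of the colimit
    in sets, tested on the points of a space, is the one in spaces
    ([topological_orbit_cdiscrete]). As [Odisc] is closed under isomorphism by
    definition, the second inclusion also needs [topological_orbit_ciso]. *)

Set Implicit Arguments.
Unset Strict Implicit.
Unset Printing Implicit Defensive.

Import Order.TTheory.

Section Monotonicity.
Variables (R : realType) (C : category) (O O' : cspace C -> Prop)
  (OO' : forall T, O T -> O' T).

Lemma categorical_mono (X : cspace C) (U : open_csubspace X) :
  categorical R O U -> categorical R O' U.
Proof. by move=> [T [OT aoH]]; exists T; split; [exact: OO'|]. Qed.

Lemma has_cat_cover_mono (X : cspace C) n :
  has_cat_cover R O X n -> has_cat_cover R O' X n.
Proof.
by move=> [U [cU catU]]; exists U; split=> // i; exact: categorical_mono.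
Qed.

Lemma lscat_anti (X : cspace C) : (lscat R O' X <= lscat R O X)%E.
Proof.
rewrite /lscat; case: pselect => [ex'|nex']; case: pselect => [ex|nex].
- rewrite lee_fin lez_nat; case: ex_minnP => m _; apply.
  by case: ex_minnP => n /asboolP On _; apply/asboolP/has_cat_cover_mono.
- by rewrite leey.
- case: nex'; case: ex => n /asboolP On.
  by exists n; apply/asboolP/has_cat_cover_mono.
- by [].
Qed.

End Monotonicity.

Section Inclusions.
Variable C : category.

Lemma set_orbit_hom (c : C) : set_orbit (hom_functor c).
Proof.
exists unit, (@SetCocone C (hom_functor c) unit (fun _ _ => tt)
                (fun _ _ _ _ => erefl)); split; last first.
  by exists id, id.
move=> Y k; exists (fun=> k c (idc c)); split=> [d h|v vk] /=.
  by rewrite -(sleg_nat k h) /= compc1.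
by apply/funext => -[]; rewrite -(vk c (idc c)).
Qed.

Definition cocone_precomp (T T' : cspace C) (L : cgspace)
    (h : cmap T T') (k : cocone T' L) : cocone T L.
Proof.
apply: (@Cocone C T L (fun c x => k c (h c x))).
- by move=> c x; apply: continuous_comp; [exact: cm_cts|exact: leg_cts].
- by move=> c d e x; rewrite cm_nat leg_nat.
Defined.

(** The cocones on isomorphic spaces correspond by precomposition with the
    isomorphism, without changing their apex. *)
Lemma topological_orbit_ciso (T T' : cspace C) :
  ciso T T' -> topological_orbit T -> topological_orbit T'.
Proof.
move=> [f [g fg]] [L [l [lcolim Lpt]]].
exists L, (cocone_precomp g l); split=> // Y k.
have [u [[cu uk] uniq_u]] := lcolim Y (cocone_precomp f k).
exists u; split=> [|v [cv vk]].
  by split=> // c x; rewrite /= uk /= (fg c).2.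
by apply: uniq_u; split=> // c x; rewrite /= -vk /= (fg c).1.
Qed.

(** The colimiting cocone is taken on the discrete one-point space rather than
    on the set colimit [L] itself; the bijection [f] from [L] to the point, with
    inverse [g], carries the universal property over. *)
Lemma topological_orbit_cdiscrete (S : setfunctor C) :
  set_orbit S -> topological_orbit (cdiscrete S).
Proof.
move=> [L [l [lcolim [f [g fK gK]]]]].
have cts_pt (Y : topologicalType) (v : cg_discrete unit -> Y) : continuous v.
  by apply/continuousP => A _; exact: discrete_open.
have cts_leg (c : C) :
    continuous ((fun=> tt) : cdiscrete S c -> cg_discrete unit).
  by move=> x; exact: cst_continuous.
exists (cg_discrete unit).
exists (@Cocone C (cdiscrete S) (cg_discrete unit) (fun _ _ => tt) cts_leg
          (fun _ _ _ _ => erefl)).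
split; last by exists id, id; split.
move=> Y k.
have [u [uk uniq_u]] :=
  lcolim Y (@SetCocone C S Y (fun c x => k c x) (@leg_nat _ _ _ k)).
exists (fun t => u (g t)); split=> [|v [_ vk]].
  split=> [|c x]; first exact: cts_pt.
  by rewrite -[RHS]uk -[in RHS](fK (l c x)); case: (f _).
have -> : u = fun y => v (f y).
  by apply: uniq_u => c x; case: (f _); exact: vk.
by apply/funext => t; rewrite gK.
Qed.

Lemma Orep_Odisc (T : cspace C) : Orep T -> Odisc T.
Proof. by move=> [c cT]; exists (hom_functor c) => //; exact: set_orbit_hom. Qed.

Lemma Odisc_Otop (T : cspace C) : Odisc T -> Otop T.
Proof.
move=> [S oS ST]; apply: (topological_orbit_ciso ST).
exact: topological_orbit_cdiscrete.
Qed.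

End Inclusions.

Theorem proposition3p5 (R : realType) (C : category) :
  (forall O O' : cspace C -> Prop,
     orbit_family O -> orbit_family O' -> (forall T, O T -> O' T) ->
     forall X : cspace C, (lscat R O' X <= lscat R O X)%E) /\
  (forall X : cspace C,
     (lscat R (@Otop C) X <= lscat R (@Odisc C) X)%E /\
     (lscat R (@Odisc C) X <= lscat R (@Orep C) X)%E).
Proof.
split=> [F F' _ _ FF' X|X]; first exact: lscat_anti.
split; apply: lscat_anti; [exact: Odisc_Otop|exact: Orep_Odisc].
Qed.
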